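(* Let $a>0$ and $0<\rho\le 1$, and let $\mathcal{K}_{\rho,a}:L^2[-a,a]\to L^2[-a,a]$ be the integral operator $$\mathcal{K}_{\rho,a}f(x)=C_\rho\int_{-a}^{a}|x-y|^{\rho}f(y)\,dy,\qquad C_\rho=\frac{-1}{2\,\Gamma(1+\rho)\,\sin\frac{\pi\rho}{2}}.$$ Then the eigenvalue problem $\mathcal{K}_{\rho,a}f=\mu f$, $f\in L^2[-a,a]$, $f\neq 0$, admits at most one negative eigenvalue, where eigenvalues are counted with multiplicity.
   Context: $L^2[-a,a]$ is the space of (real-valued) square integrable functions on $[-a,a]$. The constant $C_\rho$ is negative for $0<\rho\le 1$, with $C_1=-1/2$; for $0<\rho<1$ it equals $\Gamma(-\rho)/\bigl(\Gamma(\tfrac{1-\rho}{2})\Gamma(\tfrac{1+\rho}{2})\bigr)$. The operator $\mathcal{K}_{\rho,a}$ is compact and self-adjoint. *)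

(* Defs.v *)
From HB Require Import structures.
From mathcomp Require Import all_boot all_order all_algebra.
From mathcomp Require Import all_classical all_reals all_analysis.
From mathcomp Require Import measurable_realfun lra.
Set Implicit Arguments.
Unset Strict Implicit.
Unset Printing Implicit Defensive.
Import Order.TTheory GRing.Theory Num.Theory.
Import numFieldNormedType.Exports.
Local Open Scope classical_set_scope.
Local Open Scope ring_scope.

(* Lebesgue measure of [-a, a], carried by the whole line. *)
Definition lebesgue_on (R : realType) (a : R) :
    set (measurableTypeR R) -> \bar R :=
  mrestr (@lebesgue_measure R) (measurable_itv `[- a, a]).

HB.instance Definition _ (R : realType) (a : R) := Measure.on (lebesgue_on a).

Lemma lebesgue_on_fin (R : realType) (a : R) : fin_num_fun (lebesgue_on a).
Proof.
move=> A mA; rewrite ge0_fin_numE//=.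
apply: (@le_lt_trans _ _ (@lebesgue_measure R `[- a, a])).
  by rewrite /lebesgue_on /mrestr; apply: le_measure; rewrite ?inE//=; exact: measurableI.
by rewrite /= lebesgue_measure_itv/=; case: ifPn => // _; rewrite -EFinD ltry.
Qed.
HB.instance Definition _ (R : realType) (a : R) :=
  Measure_isFinite.Build _ _ _ (lebesgue_on a) (@lebesgue_on_fin R a).

(* Elements are representatives: functions on the line whose values off
   [-a, a] are irrelevant.  Equality in the Hilbert space L^2[-a, a] is
   equality modulo [ae lebesgue_on a], never equality in this type. *)
Definition L2 (R : realType) (a : R) := LfunType (lebesgue_on a) (lee1n 2).

(* Euler's integral; it converges for 0 < s, and is only used there. *)
Definition Gamma (R : realType) (s : R) : R :=
  \int[@lebesgue_measure R]_(t in `]0, +oo[) (t `^ (s - 1) * expR (- t)).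

Definition C_ (R : realType) (rho : R) : R :=
  -1 / (2 * Gamma (1 + rho) * sin (pi * rho / 2)).

Definition Kop (R : realType) (rho a : R) (f : R -> R) (x : R) : R :=
  C_ rho * \int[@lebesgue_measure R]_(y in `[- a, a]) (`|x - y| `^ rho * f y).

Lemma Kop_in_L2 (R : realType) (rho a : R) (f : L2 a) :
  0 <= rho -> Kop rho a f \in Lfun (lebesgue_on a) 2%:E.
Proof.
move=> rho0; set nu := lebesgue_on a; set D : set R := `[- a, a]%classic.
have mD : measurable D by exact: measurable_itv.
have nuD : nu (~` D) = 0%E by rewrite /nu /D /= /lebesgue_on /mrestr setICl measure0.
have mg0 : measurable_fun setT
    (fun z : R * R => (`|z.1 - z.2| `^ rho * f z.2)).
  apply: measurable_funM; last first.
    exact: (measurableT_comp (measurable_funPT f) measurable_snd).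
  apply: (@measurableT_comp _ _ _ _ _ _ (@powR R ^~ rho)) => //.
  by apply: measurableT_comp => //; exact: measurable_funB.
have inL1 : nu.-integrable setT (EFin \o f).
  apply/Lfun1_integrable/(Lfun_subset12 (fin_num_measure nu _ measurableT)).
  exact: LfunP.
have switch (h : R -> \bar R) :
    (\int[@lebesgue_measure R]_(y in D) h y = \int[nu]_(y in D) h y)%E.
  by apply: eq_measure_integral => A mA AD; rewrite /= /lebesgue_on /mrestr/= setIidl.
have inD : nu.-integrable D (EFin \o f).
  exact: (integrableS measurableT).
have mK : measurable_fun setT (Kop rho a f).
  apply: measurable_funM => //.
  apply: (measurableT_comp (fine_measurable measurableT)).
  pose F (z : R * R) := (`|z.1 - z.2| `^ rho * (f \_ D) z.2)%:E.
  have mfD : measurable_fun setT (f \_ D).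
    by apply/(measurable_restrictT _ mD); exact: (measurable_funTS (measurable_funPT f)).
  have mF : measurable_fun setT F.
    apply/measurable_EFinP; apply: measurable_funM; last exact: (measurableT_comp mfD measurable_snd).
    apply: (@measurableT_comp _ _ _ _ _ _ (@powR R ^~ rho)) => //.
    by apply: measurableT_comp => //; exact: measurable_funB.
  rewrite (_ : (fun x => _) = (fun x =>
    \int[@lebesgue_measure R]_y F^\+ (x, y) - \int[@lebesgue_measure R]_y F^\- (x, y))%E).
    apply: emeasurable_funB; apply: measurable_fun_fubini_tonelli_F => //.
      exact: measurable_funepos.
    exact: measurable_funeneg.
  apply/funext => x; rewrite integral_mkcond integralE.
  have -> : ((fun y => (`|x - y| `^ rho * f y)%:E) \_ D) = (fun y => F (x, y)).
    by apply/funext => y; rewrite /F /patch; case: ifPn => //= _; rewrite mulr0.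
  congr (_ - _)%E; apply: eq_integral => y _; by rewrite ?funeposE ?funenegE.
rewrite inE; apply/andP; split; rewrite inE //= /finite_norm unlock.
apply: poweR_lty.
pose M := `|C_ rho| * ((2 * a) `^ rho * fine (\int[nu]_(y in D) `|(f y)%:E|)).
apply: (@le_lt_trans _ _ (\int[nu]_x (cst (M `^ 2)%:E) x)%E); last first.
  rewrite integral_cst//; apply/lte_mul_pinfty => //; first by rewrite lee_fin powR_ge0.
  by rewrite -ge0_fin_numE// fin_num_measure.
apply: ae_ge0_le_integral => //.
- by move=> x _; exact: poweR_ge0.
- apply: (@measurableT_comp _ _ _ _ _ _ (@poweR R ^~ 2%R)).
    exact: measurable_poweR.
  by apply: measurableT_comp => //; exact/measurable_EFinP.
- by move=> x _; rewrite lee_fin powR_ge0.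
exists (~` D); split => //; first exact: measurableC.
apply: subsetC => x Dx _.
rewrite /= lee_fin ge0_ler_powR// ?nnegrE//.
  by rewrite /M !mulr_ge0 ?powR_ge0// fine_ge0// integral_ge0.
rewrite normrM ler_wpM2l//.
have ig : nu.-integrable D (EFin \o (fun y => (2 * a) `^ rho * f y)).
  by rewrite (_ : _ \o _ = (fun y => ((2 * a) `^ rho)%:E * (f y)%:E)%E) //; exact: integrableZl.
have le_g y : D y -> `|x - y| `^ rho <= (2 * a) `^ rho.
  move: Dx; rewrite /D /= !in_itv /= => /andP[x1 x2] /andP[y1 y2].
  by rewrite ge0_ler_powR ?nnegrE//; [lra|rewrite ler_norml; lra].
have ih : nu.-integrable D (EFin \o (fun y => `|x - y| `^ rho * f y)).
  apply: le_integrable ig => //.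
    apply/measurable_EFinP/measurable_funTS; exact: (measurableT_comp mg0 (pair1_measurable x)).
  move=> y Dy; rewrite /= lee_fin !normrM ler_wpM2r//.
  by rewrite !(ger0_norm (powR_ge0 _ _)) le_g.
rewrite /Rintegral switch.
rewrite -lee_fin.
have fK : (\int[nu]_(y in D) (`|x - y| `^ rho * f y)%:E)%E \is a fin_num.
  exact: integrable_fin_num.
rewrite -abse_EFin fineK//.
apply: (le_trans (le_abse_integral _ _ _)) => //; first by case/integrableP: ih.
rewrite EFinM fineK; last by apply: integrable_fin_num => //; exact: integrable_abse.
have mabsf : measurable_fun D (fun y => `|f y|%:E).
  apply/measurable_EFinP/measurable_funTS.
  exact: (measurableT_comp (@normr_measurable R setT) (measurable_funPT f)).
rewrite -ge0_integralZl//=; last by rewrite lee_fin powR_ge0.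
apply: ge0_le_integral => //.
- by case/integrableP: ih => mh _; exact: (measurableT_comp (@abse_measurable R setT) mh).
- exact: measurable_funeM.
- move=> y Dy; rewrite -EFinM lee_fin normrM ler_wpM2r//.
  by rewrite !(ger0_norm (powR_ge0 _ _)) le_g.
Qed.

Definition eigen_subspace (R : realType) (rho a m : R) : set (L2 a) :=
  [set f : L2 a | Kop rho a f = (m *: f : L2 a) %[ae lebesgue_on a] ].

Definition is_eigenvalue (R : realType) (rho a m : R) : Prop :=
  exists f : L2 a,
    eigen_subspace rho m f /\ ~ (f = (0 : L2 a) %[ae lebesgue_on a]).

(* Linear independence in L^2[-a, a], hence modulo a.e. equality. *)
Definition independent (R : realType) (a : R) (n : nat) (u : 'I_n -> L2 a) :=
  forall c : 'I_n -> R,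
    (\sum_(i < n) c i *: u i : L2 a) = (0 : L2 a) %[ae lebesgue_on a] ->
    forall i, c i = 0.

(* Dimension, possibly +oo, of the eigenspace of m in L^2[-a, a]. *)
Definition multiplicity (R : realType) (rho a m : R) : \bar R :=
  ereal_sup [set n%:R%:E | n in [set n | exists u : 'I_n -> L2 a,
    (forall i, eigen_subspace rho m (u i)) /\ independent u] ].

(* Main.v *)
Require Import Defs.
From mathcomp Require Import all_boot all_order all_algebra.
From mathcomp Require Import all_classical all_reals all_analysis.
From mathcomp Require Import measurable_realfun ring lra zify.
Import Order.TTheory GRing.Theory Num.Theory.
Import numFieldNormedType.Exports.
Local Open Scope classical_set_scope.
Local Open Scope ring_scope.

(** The kernel [C_ rho * |x - y| ^ rho] is conditionally positive definite: the
    quadratic form [<K f, f>] is nonnegative on the functions of mean zero,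
    a subspace of codimension one.  Two independent eigenfunctions with
    negative eigenvalues would span a plane on which this form is negative
    definite (eigenfunctions of distinct eigenvalues are orthogonal, [K] being
    symmetric), and that plane would contain a nonzero function of mean zero.
    The constant enters through its sign ([C_le0]).

    Conditional positivity and symmetry come from one discretisation, which
    replaces any Fourier or Fubini argument.  Cut [-a, a] into cells of width
    [h] and replace [|x - y| ^ rho] by [(h |i - j|) ^ rho] when [x] lies in cell
    [i] and [y] in cell [j].  Since [t ^ rho] is subadditive for [rho <= 1], the
    error is at most [h ^ rho], uniformly.  The form becomes a finite double sum
    over the cell integrals [v_i] ([Kform_approx]), which is symmetric, and
    [v] sums to zero when the function has mean zero.

    For such [v], the sum of [phi |i - j| v_i v_j] is nonpositive for every
    nondecreasing discretely concave [phi] ([concave_cond_neg]): on an initial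
    segment of the integers, [phi] is a constant minus a combination, with
    nonnegative coefficients, of the functions [(s - k)^+], and the matrix
    [(s - |i - j|)^+] is the Gram matrix of the indicators of the windows
    [i, i + s) ([triangle_psd]). *)

Set Implicit Arguments.
Unset Strict Implicit.
Unset Printing Implicit Defensive.

(** * Concave functions of the distance between integers *)

(** Written with truncated subtractions, so that linear arithmetic on [nat]
    applies to it directly. *)
Definition ndist (i j : nat) : nat := (i - j + (j - i))%N.

Lemma sum_window (s N i : nat) : (i + s <= N)%N ->
  (\sum_(z < N) (i <= z < i + s) = s)%N.
Proof.
move=> iN; rewrite -(big_mkord xpredT (fun z => (i <= z < i + s) : nat)).
rewrite (@big_cat_nat _ _ _ i) //=; last lia.
rewrite (@big_cat_nat _ _ _ (i + s)%N i N) //=; last lia.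
rewrite big_nat_cond big1 => [|z]; last by lia.
rewrite (eq_big_nat _ _ (F2 := fun=> 1%N)) => [|z]; last by lia.
rewrite sum_nat_const_nat big_nat_cond big1 => [|z]; last by lia.
by lia.
Qed.

(** Two windows of length [s] starting at [i] and [j] meet in a window of length
    [s - |i - j|]. *)
Lemma sum_window2 (s N i j : nat) : (i + s <= N)%N -> (j + s <= N)%N ->
  (\sum_(z < N) (i <= z < i + s) * (j <= z < j + s) = s - ndist i j)%N.
Proof.
move=> iN jN.
rewrite -(@sum_window (s - ndist i j) N (maxn i j)); last by rewrite /ndist; lia.
by apply: eq_bigr => z _; rewrite /ndist; lia.
Qed.

(** By [sum_window2] the quadratic form is the sum over [z] of the squares of the
    sums of [v] over the indices whose window contains [z]. *)
Lemma triangle_psd (R : realFieldType) (n s : nat) (v : 'I_n -> R) :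
  0 <= \sum_(i < n) \sum_(j < n) (s - ndist i j)%:R * v i * v j.
Proof.
set N := (n + s)%N.
suff -> : \sum_(i < n) \sum_(j < n) (s - ndist i j)%:R * v i * v j =
   \sum_(z < N) (\sum_(i < n) (i <= z < i + s)%:R * v i) ^+ 2.
  by apply: sumr_ge0 => z _; exact: sqr_ge0.
transitivity (\sum_(i < n) \sum_(j < n) \sum_(z < N)
    ((i <= z < i + s)%:R * v i) * ((j <= z < j + s)%:R * v j)).
  apply: eq_bigr => i _; apply: eq_bigr => j _.
  rewrite -(@sum_window2 s N i j); [|rewrite /N; have := ltn_ord i; have := ltn_ord j; lia..].
  rewrite natr_sum !mulr_suml; apply: eq_bigr => z _.
  by rewrite natrM; ring.
under eq_bigr do rewrite exchange_big/=.
rewrite exchange_big/=; apply: eq_bigr => z _.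
by rewrite expr2 mulr_suml; apply: eq_bigr => i _; rewrite mulr_sumr.
Qed.

(** Discrete Taylor formula at [N]: a sequence is determined by its value and
    slope at [N] and by its second differences.  The truncated [s - k] vanishes
    for [s <= k], so that only the second differences between [k] and [N]
    contribute. *)
Lemma concave_tents (R : realFieldType) (phi : nat -> R) (N k : nat) : (k <= N)%N ->
  phi k = phi N - (phi N.+1 - phi N) * (N - k)%:R
   - \sum_(1 <= s < N.+1) (2 * phi s - phi s.-1 - phi s.+1) * (s - k)%:R.
Proof.
elim: N => [|N IH].
  by rewrite leqn0 => /eqP ->; rewrite big_geq// subnn mulr0 !subr0.
rewrite leq_eqVlt => /orP[/eqP ->|].
  rewrite subnn big_nat big1 ?mulr0 ?subr0// => s s1.
  by rewrite (_ : (s - N.+1)%N = 0%N) ?mulr0//; lia.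
rewrite ltnS => kN.
rewrite big_nat_recr//= IH// subSn// -natr1; ring.
Qed.

(** In the expansion [concave_tents] the constant term contributes
    [phi n * (sum v) ^ 2], which is zero, and every other term is a nonpositive
    multiple of a form from [triangle_psd]. *)
Lemma concave_cond_neg (R : realFieldType) (phi : nat -> R) (n : nat) (v : 'I_n -> R) :
  {homo phi : i j / (i <= j)%N >-> i <= j} ->
  (forall k, phi k + phi k.+2 <= 2 * phi k.+1) ->
  \sum_(i < n) v i = 0 -> \sum_(i < n) \sum_(j < n) phi (ndist i j) * v i * v j <= 0.
Proof.
move=> phi_le phi_concave v0.
pose c s := 2 * phi s - phi s.-1 - phi s.+1.
have -> : \sum_(i < n) \sum_(j < n) phi (ndist i j) * v i * v j =
  phi n * (\sum_(i < n) v i) ^+ 2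
  - (phi n.+1 - phi n) * (\sum_(i < n) \sum_(j < n) (n - ndist i j)%:R * v i * v j)
  - \sum_(1 <= s < n.+1) c s * (\sum_(i < n) \sum_(j < n) (s - ndist i j)%:R * v i * v j).
  transitivity (\sum_(i < n) \sum_(j < n) (phi n * v i * v j
    - (phi n.+1 - phi n) * ((n - ndist i j)%:R * v i * v j)
    - \sum_(1 <= s < n.+1) c s * ((s - ndist i j)%:R * v i * v j))).
    apply: eq_bigr => i _; apply: eq_bigr => j _.
    rewrite (@concave_tents R phi n (ndist i j)); last first.
      by rewrite /ndist; have := ltn_ord i; have := ltn_ord j; lia.
    rewrite !mulrBl !mulr_suml -!mulrA; congr (_ - _).
    by apply: eq_bigr => s _; rewrite !mulrA.
  under eq_bigr do rewrite sumrB sumrB.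
  rewrite sumrB sumrB; congr (_ - _ - _).
  - rewrite expr2 mulr_suml mulr_sumr; apply: eq_bigr => i _.
    by rewrite !mulr_sumr; apply: eq_bigr => j _; rewrite mulrA.
  - by rewrite mulr_sumr; apply: eq_bigr => i _; rewrite mulr_sumr.
  - under eq_bigr do rewrite exchange_big/=.
    rewrite exchange_big/=; apply: eq_bigr => s _.
    by rewrite mulr_sumr; apply: eq_bigr => i _; rewrite mulr_sumr.
rewrite v0 expr0n mulr0 sub0r -opprD oppr_le0 addr_ge0//.
  by rewrite mulr_ge0 ?triangle_psd// subr_ge0 phi_le.
rewrite big_nat sumr_ge0// => s /andP[s1 _].
rewrite mulr_ge0 ?triangle_psd// /c.
by case: s s1 => // s _ /=; have := phi_concave s; lra.
Qed.

(** * Concavity and subadditivity of real powers *)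

(** Midpoint convexity of the inverse function, the power [rho^-1 >= 1], at the
    points [x `^ rho] and [y `^ rho]. *)
Lemma powR_midconcave (R : realType) (rho x y : R) : 0 < rho -> rho <= 1 -> 0 <= x -> 0 <= y ->
  x `^ rho + y `^ rho <= 2 * ((x + y) / 2) `^ rho.
Proof.
move=> rho0 rho1 x0 y0.
have ri1 : 1 <= rho^-1 by rewrite invf_ge1.
have r0 : rho != 0 by rewrite gt_eqF.
have xK z : 0 <= z -> (z `^ rho) `^ rho^-1 = z.
  by move=> z0; rewrite -powRrM divff// powRr1.
have h : ((x `^ rho + y `^ rho) / 2) `^ rho^-1 <= (x + y) / 2.
  have h0 : 0 <= 2^-1 :> R by lra.
  have h1 : 2^-1 <= 1 :> R by lra.
  have := @convex_powR R _ ri1 (Itv01 h0 h1) (x `^ rho) (y `^ rho).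
  rewrite !inE/= !in_itv/= !powR_ge0 => /(_ isT isT).
  rewrite convRE [X in X `^ _ <= _ -> _]convRE !xK//= /unstable.onem.
  set u := _ `^ _; set w := _ `^ _.
  have -> : u = w; last by lra.
  by rewrite /u /w; congr powR; lra.
have := @ge0_ler_powR _ rho (ltW rho0) _ _ _ _ h.
rewrite !nnegrE powR_ge0 divr_ge0 ?addr_ge0// => /(_ isT isT).
by rewrite -powRrM mulVf// powRr1 ?divr_ge0 ?addr_ge0 ?powR_ge0//; lra.
Qed.

(** For [z <= x + y] the ratio [z / (x + y)] lies in [0, 1], hence is at most its
    power [rho]; add these bounds for [z = x] and [z = y]. *)
Lemma powR_subadd (R : realType) (rho x y : R) : 0 < rho -> rho <= 1 -> 0 <= x -> 0 <= y ->
  (x + y) `^ rho <= x `^ rho + y `^ rho.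
Proof.
move=> rho0 rho1 x0 y0.
have r0 : rho != 0 by rewrite gt_eqF.
have [s0|s0] := eqVneq (x + y) 0.
  by rewrite s0 powR0// addr_ge0// powR_ge0.
have sp : 0 < x + y by rewrite lt_def s0 addr_ge0.
have share z : 0 <= z -> z <= x + y -> z / (x + y) * (x + y) `^ rho <= z `^ rho.
  move=> z0 zs; have [->|zn0] := eqVneq z 0; first by rewrite mul0r mul0r powR_ge0.
  rewrite -[in leRHS](@divfK _ (x + y) s0 z) powRM ?divr_ge0 ?(ltW sp)//.
  have zp : 0 < z by rewrite lt_def zn0.
  by rewrite ler_wpM2r ?powR_ge0// ger1_powR// divr_gt0//= ler_pdivrMr// mul1r.
have := share _ x0; rewrite lerDl => /(_ y0).
have := share _ y0; rewrite lerDr => /(_ x0).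
move=> hy hx; rewrite -[leLHS]mul1r -(divff s0) mulrDl mulrDl.
exact: lerD.
Qed.

Lemma powR_dist (R : realType) (rho x y : R) : 0 < rho -> rho <= 1 -> 0 <= x -> 0 <= y ->
  `|x `^ rho - y `^ rho| <= `|x - y| `^ rho.
Proof.
move=> rho0 rho1.
wlog xy : x y / x <= y => [wl|x0 y0].
  move=> x0 y0; have [/wl|/ltW /wl] := leP x y; first exact.
  by move=> /(_ y0 x0); rewrite distrC (distrC y).
have mono : x `^ rho <= y `^ rho by rewrite ge0_ler_powR ?nnegrE// ltW.
rewrite distrC [in leRHS]distrC !ger0_norm ?subr_ge0//.
rewrite lerBlDr -[in leLHS](subrK x y) powR_subadd// subr_ge0//.
Qed.

(** * Bilinear forms of kernels close to step kernels *)

Section step_kernels.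
Context d (T : measurableType d) (R : realType) (mu : {measure set T -> \bar R}).
Variables (D : set T) (mD : measurable D).

Lemma Rintegral_sum (n : nat) (f : 'I_n -> T -> R) :
  (forall i, mu.-integrable D (EFin \o f i)) ->
  \int[mu]_(x in D) (\sum_(i < n) f i x) = \sum_(i < n) \int[mu]_(x in D) f i x.
Proof.
move=> intf; rewrite /Rintegral.
under eq_integral do rewrite -sumEFin.
rewrite (@integral_sum _ _ _ mu D mD _ (fun i x => (f i x)%:E))//.
rewrite -sum_fine// => i _; exact: (integrable_fin_num mD (intf i)).
Qed.

Variables (n : nat) (p : T -> 'I_n).
Hypothesis mp : forall i, measurable (D `&` p @^-1` [set i]).

Definition cell_integral (f : T -> R) (i : 'I_n) :=
  \int[mu]_(x in D `&` p @^-1` [set i]) f x.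

Lemma step_mulE (c : 'I_n -> R) (f : T -> R) x :
  c (p x) * f x = \sum_(i < n) c i * (f \_ (p @^-1` [set i])) x.
Proof.
rewrite (bigD1 (p x))//= patchE mem_set// big1 ?addr0// => i ip.
by rewrite patchE memNset ?mulr0// => /= pi; move: ip; rewrite pi eqxx.
Qed.

Lemma integrable_cell (f : T -> R) i : mu.-integrable D (EFin \o f) ->
  mu.-integrable D (EFin \o (f \_ (p @^-1` [set i]))).
Proof.
move=> intf; rewrite -restrict_EFin.
apply/(integrable_mkcond _ mD).
rewrite -patch_setI.
apply/(integrable_mkcond _ (mp i)).
by apply: integrableS intf => //; exact: subIsetl.
Qed.

Lemma integrable_step (c : 'I_n -> R) (f : T -> R) :
  mu.-integrable D (EFin \o f) ->
  mu.-integrable D (EFin \o (fun x => c (p x) * f x)).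
Proof.
move=> intf.
rewrite (_ : _ \o _ = fun x => (\sum_(i < n) (c i)%:E * (EFin \o (f \_ (p @^-1` [set i]))) x)%E).
  by apply: integrable_sum => // i _; apply: integrableZl => //; exact: integrable_cell.
by apply/funext => x; rewrite /= step_mulE -sumEFin.
Qed.

Lemma Rintegral_step (c : 'I_n -> R) (f : T -> R) :
  mu.-integrable D (EFin \o f) ->
  \int[mu]_(x in D) (c (p x) * f x) = \sum_(i < n) c i * cell_integral f i.
Proof.
move=> intf; under eq_Rintegral do rewrite step_mulE.
rewrite Rintegral_sum; last first.
  move=> i; rewrite (_ : _ \o _ = fun x => ((c i)%:E * (EFin \o (f \_ (p @^-1` [set i]))) x)%E)//.
  by apply: integrableZl => //; exact: integrable_cell.
apply: eq_bigr => i _; rewrite RintegralZl//; last exact: integrable_cell.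
by rewrite /cell_integral Rintegral_mkcondr.
Qed.

Lemma sum_cell_integral (f : T -> R) : mu.-integrable D (EFin \o f) ->
  \sum_(i < n) cell_integral f i = \int[mu]_(x in D) f x.
Proof.
move=> intf; under eq_bigr do rewrite -[cell_integral _ _]mul1r.
rewrite -(Rintegral_step (fun=> 1))//.
by under eq_Rintegral do rewrite mul1r.
Qed.

(** The form of the step kernel [w (p x) (p y)] is exactly the finite sum.
    Integrating the uniform bound [e] first in [y] and then in [x], as iterated
    integrals, avoids any product measure. *)
Lemma kernel_form_approx (k : T -> T -> R) (w : 'I_n -> 'I_n -> R) (e : R) (f g : T -> R) :
  (forall x y, D x -> D y -> `|k x y - w (p x) (p y)| <= e) ->
  mu.-integrable D (EFin \o f) -> mu.-integrable D (EFin \o g) ->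
  (forall x, D x -> mu.-integrable D (EFin \o (fun y => k x y * f y))) ->
  mu.-integrable D (EFin \o (fun x => (\int[mu]_(y in D) (k x y * f y)) * g x)) ->
  `|\int[mu]_(x in D) ((\int[mu]_(y in D) (k x y * f y)) * g x)
    - \sum_(i < n) \sum_(j < n) w i j * cell_integral f j * cell_integral g i|
  <= e * (\int[mu]_(x in D) `|f x|) * (\int[mu]_(x in D) `|g x|).
Proof.
move=> kw intf intg intkf intkfg.
pose c i := \sum_(j < n) w i j * cell_integral f j.
have inner x : D x ->
    `|\int[mu]_(y in D) (k x y * f y) - c (p x)| <= e * \int[mu]_(y in D) `|f y|.
  move=> Dx; have iw := integrable_step (w (p x)) intf.
  rewrite /c -(Rintegral_step (w (p x)))// -RintegralB//; last exact: intkf.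
  have iB : mu.-integrable D (EFin \o (fun y => k x y * f y - w (p x) (p y) * f y)).
    by apply: (integrableB mD (intkf _ Dx) iw).
  apply: le_trans (le_normr_Rintegral mD iB) _.
  rewrite -RintegralZl//; last exact: integrable_norm.
  apply: le_Rintegral => //.
  - exact: (integrable_norm iB).
  - apply: (integrableZl mD e (integrable_norm intf)).
  - by move=> y Dy; rewrite -mulrBl normrM ler_wpM2r// kw.
have ic := integrable_step c intg.
have -> : \sum_(i < n) \sum_(j < n) w i j * cell_integral f j * cell_integral g i =
    \int[mu]_(x in D) (c (p x) * g x).
  by rewrite Rintegral_step//; apply: eq_bigr => i _; rewrite mulr_suml.
rewrite -RintegralB//.
have iB := integrableB mD intkfg ic.
apply: le_trans (le_normr_Rintegral mD iB) _.
rewrite -RintegralZl//; last exact: integrable_norm.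
apply: le_Rintegral => //.
- exact: (integrable_norm iB).
- apply: (integrableZl mD _ (integrable_norm intg)).
- by move=> x Dx; rewrite -mulrBl normrM ler_wpM2r// inner.
Qed.
End step_kernels.

(** * The discretised form of the operator *)

Lemma le0_of_le_eps (R : realFieldType) (x M : R) :
  (forall e, 0 < e -> x <= e * M) -> x <= 0.
Proof.
move=> xM; rewrite leNgt; apply/negP => x0.
have M1 : 0 < `|M| + 1 by rewrite ltr_wpDl.
have := xM (x / 2 / (`|M| + 1)); rewrite !divr_gt0// => /(_ isT).
apply/negP; rewrite -ltNge (@le_lt_trans _ _ (x / 2))//; last by lra.
rewrite mulrAC ler_pdivrMr// ler_pM2l ?divr_gt0// (le_trans (ler_norm _))//.
by rewrite lerDl.
Qed.

(** Euler's integral is nonnegative whether or not it converges, and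
    [pi * rho / 2] lies in the open interval from [0] to [pi]; a possible
    vanishing of the denominator is harmless as [0^-1 = 0]. *)
Lemma C_le0 (R : realType) (rho : R) : 0 < rho -> rho <= 1 -> C_ rho <= 0.
Proof.
move=> rho0 rho1; rewrite /C_ mulN1r oppr_le0 invr_ge0.
rewrite !mulr_ge0//.
  by apply: Rintegral_ge0 => t _; rewrite mulr_ge0 ?powR_ge0 ?expR_ge0.
have pp := pi_gt0 R.
apply/ltW/sin_gt0_pi; rewrite divr_gt0 ?mulr_gt0//= ltr_pdivrMr//.
by rewrite ltr_pM2l//; lra.
Qed.

Lemma natr_ndist (R : realDomainType) (i j : nat) : (ndist i j)%:R = `|i%:R - j%:R| :> R.
Proof.
wlog ij : i j / (i <= j)%N => [wl|].
  have [/wl//|/ltnW /wl] := leqP i j.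
  by rewrite distrC /ndist addnC.
rewrite /ndist (eqP ij) add0n natrB// distrC ger0_norm// subr_ge0 ler_nat//.
Qed.

Section operator.
Context (R : realType) (rho a : R).
Hypotheses (rho_gt0 : 0 < rho) (rho_le1 : rho <= 1).
Let nu : {measure set (measurableTypeR R) -> \bar R} := lebesgue_on a.
Let D : set (measurableTypeR R) := `[- a, a]%classic.
Let mD : measurable D. Proof. exact: measurable_itv. Qed.

Let kernel (x y : R) : R := C_ rho * `|x - y| `^ rho.

Lemma L2_integrable (f : L2 a) : nu.-integrable D (EFin \o f).
Proof.
apply: (integrableS measurableT) => //.
apply/Lfun1_integrable/(Lfun_subset12 (fin_num_measure nu _ measurableT)).
exact: LfunP.
Qed.

Lemma Lfun2_mul_integrable (f g : R -> R) : f \in Lfun nu 2%:E -> g \in Lfun nu 2%:E ->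
  nu.-integrable D (EFin \o (fun x => f x * g x)).
Proof.
move=> lf lg; apply: (integrableS measurableT) => //.
exact/Lfun1_integrable/Lfun2_mul_Lfun1.
Qed.

Lemma integrable_powR_dist (f : R -> R) x : D x -> nu.-integrable D (EFin \o f) ->
  nu.-integrable D (EFin \o (fun y => `|x - y| `^ rho * f y)).
Proof.
move=> Dx intf.
have ig : nu.-integrable D (EFin \o (fun y => (2 * a) `^ rho * f y)).
  exact: (integrableZl mD ((2 * a) `^ rho) intf).
apply: le_integrable ig => //.
  apply/measurable_EFinP/measurable_funM; last first.
    by apply/measurable_EFinP; case/integrableP: intf.
  apply: (@measurableT_comp _ _ _ _ _ _ (@powR R ^~ rho)) => //.
  by apply: measurableT_comp => //; exact: measurable_funB.
move=> y Dy; rewrite /= lee_fin !normrM ler_wpM2r// !(ger0_norm (powR_ge0 _ _)).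
move: Dx Dy; rewrite /D /= !in_itv /= => /andP[x1 x2] /andP[y1 y2].
by rewrite ge0_ler_powR ?nnegrE ?(ltW rho_gt0)//; [lra|rewrite ler_norml; lra].
Qed.

Lemma integrable_kernel (f : R -> R) x : D x -> nu.-integrable D (EFin \o f) ->
  nu.-integrable D (EFin \o (fun y => kernel x y * f y)).
Proof.
move=> Dx intf.
have := integrableZl mD (C_ rho) (integrable_powR_dist Dx intf).
by apply: eq_integrable => // y _; rewrite /kernel /= -!EFinM mulrA.
Qed.

Lemma KopE (f : R -> R) x : nu.-integrable D (EFin \o f) -> D x ->
  Kop rho a f x = \int[nu]_(y in D) (kernel x y * f y).
Proof.
move=> intf Dx; under eq_Rintegral do rewrite /kernel -mulrA.
rewrite RintegralZl//; last exact: integrable_powR_dist.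
congr (_ * fine _); apply: eq_measure_integral => A mA AD.
by rewrite /= /lebesgue_on /mrestr/= setIidl.
Qed.

Definition Kform (f g : R -> R) : R := \int[nu]_(x in D) (Kop rho a f x * g x).

(** The number of cells counts one more than the integer part of [2 a / h], since
    the last cell may stick out of the interval; off the interval the value is
    arbitrary. *)
Definition cell (h x : R) : 'I_(Num.truncn (2 * a / h)).+1 :=
  inord (Num.truncn ((x + a) / h)).

Lemma cell_bounds h x : 0 < h -> D x ->
  (cell h x)%:R * h <= x + a < (cell h x).+1%:R * h.
Proof.
move=> h0; rewrite /D /= in_itv/= => /andP[ax xa].
have xa0 : 0 <= (x + a) / h by rewrite divr_ge0 ?(ltW h0)//; lra.
rewrite /cell inordK; last first.
  by rewrite ltnS le_truncn// ler_pM2r ?invr_gt0//; lra.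
have /andP[lo hi] := truncn_itv xa0.
by rewrite -ler_pdivlMr// lo -ltr_pdivrMr.
Qed.

Lemma measurable_cell h i : 0 < h -> measurable (D `&` cell h @^-1` [set i]).
Proof.
move=> h0.
rewrite (_ : _ `&` _ = D `&` `[i%:R * h - a, i.+1%:R * h - a[%classic).
  by apply: measurableI => //; exact: measurable_itv.
apply/seteqP; split => x /=.
  move=> [Dx <-]; split => //; rewrite in_itv/= lerBlDr ltrBrDr.
  exact: cell_bounds.
move=> [Dx]; rewrite in_itv/= lerBlDr ltrBrDr => /andP[lo hi]; split => //.
have /andP[lo' hi'] := cell_bounds h0 Dx.
apply/val_inj/eqP; rewrite eqn_leq.
have le_of (k l : nat) : k%:R * h < l.+1%:R * h -> (k <= l)%N.
  by rewrite ltr_pM2r// ltr_nat.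
by rewrite !le_of// ?(le_lt_trans lo' hi) ?(le_lt_trans lo hi').
Qed.

(** Each of [x] and [y] is within [h] of the left end of its cell, on the same
    side, so the two errors partly cancel in the difference. *)
Lemma cell_dist h x y : 0 < h -> D x -> D y ->
  `| `|x - y| - h * (ndist (cell h x) (cell h y))%:R | <= h.
Proof.
move=> h0 Dx Dy; rewrite natr_ndist.
have /andP[lx ux] := cell_bounds h0 Dx; have /andP[ly uy] := cell_bounds h0 Dy.
have <- z : `|h * z| = h * `|z| by rewrite normrM gtr0_norm.
apply: le_trans (ler_dist_dist _ _) _.
by rewrite ler_norml; move: ux uy lx ly; rewrite -!natr1; nra.
Qed.

Definition cell_weight h (n : nat) (i j : 'I_n) : R := C_ rho * (h * (ndist i j)%:R) `^ rho.

Lemma kernel_cell h x y : 0 < h -> D x -> D y ->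
  `|kernel x y - cell_weight h (cell h x) (cell h y)| <= `|C_ rho| * h `^ rho.
Proof.
move=> h0 Dx Dy; rewrite /kernel /cell_weight -mulrBr normrM ler_wpM2l//.
apply: le_trans (powR_dist _ _ _ _) _ => //; first by rewrite mulr_ge0 ?(ltW h0).
by rewrite ge0_ler_powR ?nnegrE ?(ltW rho_gt0) ?(ltW h0)// cell_dist.
Qed.

Lemma cell_weight_sym h n (i j : 'I_n) : cell_weight h i j = cell_weight h j i.
Proof. by rewrite /cell_weight /ndist addnC. Qed.

Lemma cell_weight_cond_pos h n (v : 'I_n -> R) : 0 < h -> \sum_(i < n) v i = 0 ->
  0 <= \sum_(i < n) \sum_(j < n) cell_weight h i j * v j * v i.
Proof.
move=> h0 v0; pose phi k := (h * k%:R) `^ rho.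
have phi0 k : 0 <= h * k%:R by rewrite mulr_ge0 ?(ltW h0).
have phi_le : {homo phi : i j / (i <= j)%N >-> i <= j}.
  move=> i j ij; rewrite /phi ge0_ler_powR ?nnegrE ?(ltW rho_gt0)//.
  by rewrite ler_pM2l// ler_nat.
have phi_conc k : phi k + phi k.+2 <= 2 * phi k.+1.
  apply: le_trans (powR_midconcave _ _ _ _) _ => //.
  rewrite (_ : (h * k%:R + h * k.+2%:R) / 2 = h * k.+1%:R)//.
  by rewrite -!natr1; field.
have := concave_cond_neg phi_le phi_conc v0.
move/(ler_wnM2l (C_le0 rho_gt0 rho_le1)); rewrite mulr0 => /le_trans; apply.
rewrite mulr_sumr le_eqVlt; apply/orP; left; apply/eqP; apply: eq_bigr => i _.
by rewrite mulr_sumr; apply: eq_bigr => j _; rewrite /cell_weight /phi; ring.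
Qed.

Lemma Kform_approx h (f g : L2 a) : 0 < h ->
  `|Kform f g - \sum_i \sum_j cell_weight h i j
      * cell_integral nu D (cell h) f j * cell_integral nu D (cell h) g i|
  <= `|C_ rho| * h `^ rho * (\int[nu]_(x in D) `|f x|) * (\int[nu]_(x in D) `|g x|).
Proof.
move=> h0.
have KE : {in D, (fun x => Kop rho a f x * g x) =1
    (fun x => (\int[nu]_(y in D) (kernel x y * f y)) * g x)}.
  by move=> x /set_mem Dx; rewrite KopE//; exact: L2_integrable.
rewrite /Kform (eq_Rintegral nu KE).
apply: kernel_form_approx => //.
- by move=> i; exact: measurable_cell.
- by move=> x y Dx Dy; exact: kernel_cell.
- exact: L2_integrable.
- exact: L2_integrable.
- by move=> x Dx; apply: integrable_kernel => //; exact: L2_integrable.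
- apply: (eq_integrable mD (EFin \o (fun x => Kop rho a f x * g x))).
    by move=> x xD; rewrite /= KE.
  apply: Lfun2_mul_integrable; last exact: LfunP.
  exact: (Kop_in_L2 f (ltW rho_gt0)).
Qed.

Lemma cell_width e : 0 < e -> exists2 h, 0 < h & `|C_ rho| * h `^ rho <= e.
Proof.
move=> e0; have C1 : 0 < `|C_ rho| + 1 by rewrite ltr_wpDl.
exists ((e / (`|C_ rho| + 1)) `^ rho^-1); first by rewrite powR_gt0// divr_gt0.
rewrite -powRrM mulVf ?gt_eqF// powRr1 ?divr_ge0 ?(ltW e0) ?(ltW C1)//.
by rewrite mulrCA ler_piMr ?(ltW e0)// ler_pdivrMr// mul1r lerDl.
Qed.

(** The approximating sums are symmetric, so the two forms differ by at most
    twice an arbitrarily small error. *)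
Lemma Kform_sym (f g : L2 a) : Kform f g = Kform g f.
Proof.
apply/eqP; rewrite -subr_eq0 -normr_le0.
pose F := \int[nu]_(x in D) `|f x|; pose G := \int[nu]_(x in D) `|g x|.
have FG0 : 0 <= F * G by rewrite mulr_ge0// Rintegral_ge0.
apply: (@le0_of_le_eps _ _ (2 * (F * G))) => e e0.
have [h h0 he] := cell_width e0.
have := Kform_approx f g h0; have := Kform_approx g f h0.
set A := (X in `|Kform g f - X|); set B := (X in `|Kform f g - X|).
have -> : B = A.
  rewrite /B /A exchange_big/=; apply: eq_bigr => i _; apply: eq_bigr => j _.
  by rewrite cell_weight_sym; ring.
rewrite -/F -/G -![_ * _ * G]mulrA -![_ * _ * F]mulrA [G * F]mulrC => gf fg.
have := ler_wpM2r FG0 he.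
move: gf fg; rewrite !ler_norml; lra.
Qed.

(** The cell integrals of [f] sum to its integral, so the approximating sums are
    nonnegative. *)
Lemma Kform_cond_pos (f : L2 a) : \int[nu]_(x in D) f x = 0 -> 0 <= Kform f f.
Proof.
move=> f0; rewrite -oppr_le0.
pose F := \int[nu]_(x in D) `|f x|.
have F0 : 0 <= F by rewrite Rintegral_ge0.
apply: (@le0_of_le_eps _ _ (F * F)) => e e0.
have [h h0 he] := cell_width e0.
have := Kform_approx f f h0; rewrite -/F -[_ * F * F]mulrA.
set A := (X in `|_ - X|) => ff.
have A0 : 0 <= A.
  apply: cell_weight_cond_pos => //; rewrite sum_cell_integral//.
    by move=> i; exact: measurable_cell.
  exact: L2_integrable.
have := ler_wpM2r (mulr_ge0 F0 F0) he.
move: ff; rewrite ler_norml; lra.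
Qed.

End operator.

(** * Eigenfunctions with negative eigenvalues *)

Section spectrum.
Context (R : realType) (rho a : R).
Hypotheses (rho_gt0 : 0 < rho) (rho_le1 : rho <= 1).
Let nu : {measure set (measurableTypeR R) -> \bar R} := lebesgue_on a.
Let D : set (measurableTypeR R) := `[- a, a]%classic.
Let mD : measurable D. Proof. exact: measurable_itv. Qed.

(** Instance search does not see through the coercion that makes [nu] a
    measure. *)
#[local] Instance ae_nu_filter : Filter (nbhs (almost_everywhere nu)) :=
  ae_filter_ringOfSetsType nu.

Definition dot (f g : R -> R) : R := \int[nu]_(x in D) (f x * g x).

Lemma ae_setT (f g : R -> R) : f = g %[ae nu in D] -> f = g %[ae nu].
Proof.
have nD : \forall x \ae nu, D x.
  exists (~` D); split => //; first exact: measurableC.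
  by rewrite /nu /= /lebesgue_on /mrestr setICl measure0.
by apply: filterS2 nD => x Dx fg _; exact: fg.
Qed.

Lemma dot_ge0 f : 0 <= dot f f.
Proof. by apply: Rintegral_ge0 => x _; rewrite -expr2 sqr_ge0. Qed.

Lemma dot_eq0 (f : L2 a) : dot f f = 0 -> f = (0 : L2 a) %[ae nu].
Proof.
move=> ff0; apply: ae_setT.
have iff := Lfun2_mul_integrable (LfunP f) (LfunP f).
have mff : measurable_fun D (fun x => (f x * f x)%:E) by case/integrableP: iff.
have /(ae_eq_integral_abs nu mD mff) : (\int[nu]_(x in D) `|(f x * f x)%:E| = 0)%E.
  rewrite -[RHS]/((0:R)%:E) -ff0 /dot /Rintegral fineK; last exact: integrable_fin_num.
  by apply: eq_integral => x _; rewrite gee0_abs// lee_fin -expr2 sqr_ge0.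
apply: filterS => x /[apply] -[] /eqP; rewrite -expr2 sqrf_eq0 => /eqP //.
Qed.

Lemma ae_eq_Rintegral (f g : R -> R) : measurable_fun D f -> measurable_fun D g ->
  f = g %[ae nu in D] -> \int[nu]_(x in D) f x = \int[nu]_(x in D) g x.
Proof.
move=> mf mg fg; congr fine; apply: ae_eq_integral => //; try exact/measurable_EFinP.
by apply: filterS fg => x /[apply] ->.
Qed.

Lemma L2_measurable (f : L2 a) : measurable_fun D f.
Proof. exact: measurable_funTS. Qed.

Lemma Kop_measurable (f : L2 a) : measurable_fun D (Kop rho a f).
Proof.
have := sub_Lfun_mfun (Kop_in_L2 f (ltW rho_gt0)).
by rewrite inE => /measurable_funTS; apply.
Qed.

Lemma eigen_Kform (m : R) (f g : L2 a) : eigen_subspace rho m f ->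
  Kform rho a f g = m * dot f g.
Proof.
move=> eigf; rewrite /dot -RintegralZl//; last first.
  exact: Lfun2_mul_integrable (LfunP f) (LfunP g).
apply: ae_eq_Rintegral.
- by apply: measurable_funM; [exact: Kop_measurable|exact: L2_measurable].
- by apply: measurable_funM => //; apply: measurable_funM; exact: L2_measurable.
have {}eigf : Kop rho a f = (m *: f : L2 a) %[ae nu] := eigf.
by apply: filterS eigf => x /(_ I) -> _; rewrite mulrA.
Qed.

Lemma KopD (f g : L2 a) x : D x ->
  Kop rho a (f + g : L2 a) x = Kop rho a f x + Kop rho a g x.
Proof.
move=> Dx; have intf := @L2_integrable _ _ f; have intg := @L2_integrable _ _ g.
have intfg := @L2_integrable _ _ (f + g : L2 a).
rewrite !KopE// -RintegralD//; [|exact: integrable_kernel..].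
by apply: eq_Rintegral => y _; rewrite -mulrDr.
Qed.

Lemma KopZ (c : R) (f : L2 a) x : D x ->
  Kop rho a (c *: f : L2 a) x = c * Kop rho a f x.
Proof.
move=> Dx; have intf := @L2_integrable _ _ f.
have intcf := @L2_integrable _ _ (c *: f : L2 a).
rewrite !KopE// -RintegralZl//; [|exact: integrable_kernel..].
by apply: eq_Rintegral => y _; rewrite mulrCA.
Qed.

Lemma KformDl (f g h : L2 a) :
  Kform rho a (f + g : L2 a) h = Kform rho a f h + Kform rho a g h.
Proof.
have iK (u : L2 a) := Lfun2_mul_integrable (Kop_in_L2 u (ltW rho_gt0)) (LfunP h).
rewrite /Kform -RintegralD//; try exact: iK.
by apply: eq_Rintegral => x /set_mem Dx; rewrite KopD// mulrDl.
Qed.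

Lemma eigen_subspaceZ (m c : R) (f : L2 a) :
  eigen_subspace rho m f -> eigen_subspace rho m (c *: f : L2 a).
Proof.
move=> eigf; apply: ae_setT.
have {}eigf : Kop rho a f = (m *: f : L2 a) %[ae nu] := eigf.
apply: filterS eigf => x /(_ I) Kf Dx.
rewrite KopZ// Kf; exact: mulrCA.
Qed.

Lemma dotC f g : dot f g = dot g f.
Proof. by apply: eq_Rintegral => x _; rewrite mulrC. Qed.

Lemma dotDD (f g : L2 a) : dot (f + g : L2 a) (f + g : L2 a) =
  dot f f + 2 * dot f g + dot g g.
Proof.
have i2 (u v : L2 a) := Lfun2_mul_integrable (LfunP u) (LfunP v).
have iL : nu.-integrable D (EFin \o (fun x => f x * f x + f x * g x)).
  exact: (integrableD mD (i2 f f) (i2 f g)).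
have iR : nu.-integrable D (EFin \o (fun x => g x * f x + g x * g x)).
  exact: (integrableD mD (i2 g f) (i2 g g)).
transitivity ((dot f f + dot f g) + (dot g f + dot g g)); last by rewrite (dotC g f); ring.
rewrite /dot -(RintegralD mD (i2 f f) (i2 f g)) -(RintegralD mD (i2 g f) (i2 g g)).
rewrite -(RintegralD mD iL iR); apply: eq_Rintegral => x _.
by rewrite -[(f + g : L2 a) x]/(f x + g x); ring.
Qed.

(** By conditional positivity
    [m <f, f> + (m + m') <f, g> + m' <g, g> >= 0].  If [m = m'], this is
    [m <f + g, f + g>] with [m < 0].  Otherwise symmetry gives [<f, g> = 0],
    and both [<f, f>] and [<g, g>] must vanish. *)
Lemma mean0_eigen_sum (m m' : R) (f g : L2 a) : m < 0 -> m' < 0 ->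
  eigen_subspace rho m f -> eigen_subspace rho m' g ->
  \int[nu]_(x in D) (f + g : L2 a) x = 0 ->
  (f + g : L2 a) = (0 : L2 a) %[ae nu] /\
  (m != m' -> f = (0 : L2 a) %[ae nu] /\ g = (0 : L2 a) %[ae nu]).
Proof.
move=> m0 m'0 eigf eigg fg0.
have := Kform_cond_pos rho_gt0 rho_le1 fg0.
rewrite KformDl !(Kform_sym rho_gt0 rho_le1 _ (f + g)) !KformDl.
have := Kform_sym rho_gt0 rho_le1 f g.
rewrite (eigen_Kform f eigf) (eigen_Kform g eigf) (eigen_Kform f eigg) (eigen_Kform g eigg).
rewrite (dotC g f).
have p0 := dot_ge0 f; have q0 := dot_ge0 g.
move=> mr; have [mm'|mm'] := eqVneq m m'.
  subst m'; move=> pos; split => //; apply: dot_eq0.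
  apply/eqP; rewrite eq_le dot_ge0 andbT dotDD; move: m0 pos; clear; nra.
have -> : dot f g = 0.
  apply/eqP; rewrite -(mulrI_eq0 _ (mulfI (_ : m - m' != 0))) ?subr_eq0//.
  by rewrite mulrBl mr subrr.
rewrite !mulr0 addr0 add0r => pos.
have p00 : dot f f = 0 by apply/eqP; rewrite eq_le p0 andbT; nra.
have q00 : dot g g = 0 by apply/eqP; rewrite eq_le q0 andbT; nra.
have f0 := dot_eq0 p00; have g0 := dot_eq0 q00.
split => //; apply: filterS2 f0 g0 => x /(_ I) fx /(_ I) gx _.
rewrite -[LHS]/(f x + g x) fx gx; exact: addr0.
Qed.

(** Some nontrivial combination of [f] and [g] has mean zero, and
    [mean0_eigen_sum] applies to its two terms.  The last conclusion is what
    separates the eigenvalues: there a nonzero coefficient forces the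
    corresponding eigenfunction itself to vanish. *)
Lemma negative_eigen_dependent (m m' : R) (f g : L2 a) : m < 0 -> m' < 0 ->
  eigen_subspace rho m f -> eigen_subspace rho m' g ->
  exists al be : R, [/\ (al != 0) || (be != 0),
    (al *: f + be *: g : L2 a) = (0 : L2 a) %[ae nu] &
    m != m' -> (al *: f : L2 a) = (0 : L2 a) %[ae nu] /\
               (be *: g : L2 a) = (0 : L2 a) %[ae nu] ].
Proof.
move=> m0 m'0 eigf eigg.
pose u := \int[nu]_(x in D) f x; pose v := \int[nu]_(x in D) g x.
have [al [be [ab0 abuv]]] : exists al be : R,
    (al != 0) || (be != 0) /\ al * u + be * v = 0.
  have [u0|u0] := eqVneq u 0.
    by exists 1, 0; rewrite oner_neq0 u0 mulr0 mul0r addr0.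
  by exists v, (- u); rewrite oppr_eq0 u0 orbT; split=> //; ring.
exists al, be.
have [] := mean0_eigen_sum m0 m'0 (eigen_subspaceZ al eigf) (eigen_subspaceZ be eigg).
  have intf := @L2_integrable _ _ f; have intg := @L2_integrable _ _ g.
  rewrite -abuv /u /v -!RintegralZl//.
  rewrite -RintegralD//.
  - exact: (integrableZl mD al intf).
  - exact: (integrableZl mD be intg).
by move=> h1 h2; split.
Qed.

Lemma ae0_scale (c : R) (f : L2 a) : c != 0 ->
  (c *: f : L2 a) = (0 : L2 a) %[ae nu] -> f = (0 : L2 a) %[ae nu].
Proof.
move=> c0; apply: filterS => x /(_ I) cf _.
by apply: (mulfI c0); rewrite -[LHS]/((c *: f : L2 a) x) cf; exact/esym/mulr0.
Qed.

Lemma negative_eigenvalue_unique (m m' : R) :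
  is_eigenvalue rho a m -> m < 0 -> is_eigenvalue rho a m' -> m' < 0 -> m = m'.
Proof.
move=> [f [eigf f0]] m0 [g [eigg g0]] m'0; apply/eqP/negPn/negP => mm'.
have [al [be [ab0 _ /(_ mm')[af0 bg0]]]] := negative_eigen_dependent m0 m'0 eigf eigg.
by case/orP: ab0 => [/ae0_scale/(_ af0)//|/ae0_scale/(_ bg0)].
Qed.

Lemma negative_multiplicity_le1 (m : R) : m < 0 -> (multiplicity rho a m <= 1)%E.
Proof.
move=> m0; apply: ge_ereal_sup => _ [n [u [eigu indu]] <-].
rewrite lee_fin -[leRHS]/(1%:R) ler_nat leqNgt; apply/negP => n1.
pose i0 := Ordinal (ltnW n1); pose i1 := Ordinal n1.
have [al [be [ab0 h _]]] := negative_eigen_dependent m0 m0 (eigu i0) (eigu i1).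
pose c i := if i == i0 then al else if i == i1 then be else 0.
suff c0 : forall i, c i = 0.
  by have := c0 i0; have := c0 i1; rewrite /c/= => b0 a0; move: ab0; rewrite a0 b0 eqxx.
apply: indu.
suff -> : \sum_(i < n) c i *: u i = al *: u i0 + be *: u i1 by [].
rewrite (bigD1 i0)//= (bigD1 i1)//= big1 ?addr0 => [|i /andP[ne0 ne1]]; first by rewrite /c/=.
by rewrite /c (negPf ne0) (negPf ne1) scale0r.
Qed.

Lemma multiplicity_ge0 (m : R) : (0 <= multiplicity rho a m)%E.
Proof.
apply: ereal_sup_ubound; exists 0%N => //.
by exists (fun=> 0); split => [[]//|c _ []].
Qed.

End spectrum.

Unset Implicit Arguments.

Theorem proposition2 (R : realType) (a rho : R) (a_gt0 : 0 < a)
    (rho_gt0 : 0 < rho) (rho_le1 : rho <= 1) :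
  (\esum_(m in [set m : R | is_eigenvalue rho a m /\ (m < 0)%R])
     multiplicity rho a m <= 1)%E.
Proof.
set S := [set m | _].
have [[m Sm]|S0] := pselect (exists m, S m); last first.
  rewrite (_ : S = set0) ?esum_set0 ?lee01//.
  by apply/seteqP; split => // m Sm; apply: S0; exists m.
have -> : S = [set m].
  apply/seteqP; split => [m' [em' m'0]|_ ->]//.
  case: Sm => em m0; exact: (negative_eigenvalue_unique rho_gt0 rho_le1 em' m'0 em m0).
rewrite esum_set1 ?multiplicity_ge0//.
by apply: negative_multiplicity_le1 => //; case: Sm.
Qed.
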